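(* Let $n\ge 2$ and let $\mathcal{D}\subseteq\binom{[n]}{2}$ be such that $\mathcal{D}^c$ is a nonempty positroid. Then the dimension of the positroid cell $S_+(\mathcal{D}^c)\subseteq\mathrm{Gr}_{\ge 0}(2,n)$ is $$n-|T_{\mathcal{D}}|+c(\mathcal{D})-4 .$$
   Context: $[n]=\{1,\dots,n\}$, $\binom{[n]}{2}$ is the set of 2-element subsets of $[n]$, and $\mathcal{D}^c=\binom{[n]}{2}\setminus\mathcal{D}$. $\mathrm{Gr}(2,n)$ is the Grassmannian of 2-dimensional subspaces of $\mathbb{R}^n$, whose points are represented as row spans of real $2\times n$ matrices of rank 2; $\mathrm{Gr}_{\ge0}(2,n)$ is the subset of points having a matrix representative all of whose maximal minors (columns taken in increasing order) are nonnegative. For nonempty $\mathcal{I}\subseteq\binom{[n]}{2}$, $S_+(\mathcal{I})$ is the set of points of $\mathrm{Gr}_{\ge0}(2,n)$ represented by a real $2\times n$ matrix $A$ such that, for $I=\{i<j\}$, the minor $\det A[I]$ on columns $i,j$ is $>0$ if $I\in\mathcal{I}$ and $=0$ if $I\notin\mathcal{I}$. $\mathcal{I}$ is called a positroid if $S_+(\mathcal{I})\ne\emptyset$, and then $S_+(\mathcal{I})$ is called a positroid cell; it is a topological cell (homeomorphic to an open ball), and its dimension is the dimension of this cell. $T_{\mathcal{D}}=\{i\in[n] : \{i,j\}\in\mathcal{D}\text{ for all }j\in[n]\setminus\{i\}\}$; $G_{\mathcal{D}}$ is the simple graph with vertex set $[n]\setminus T_{\mathcal{D}}$ and edge set $\{\{i,j\}\in\mathcal{D}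 : i,j\notin T_{\mathcal{D}}\}$; $c(\mathcal{D})$ is the number of connected components of $G_{\mathcal{D}}$ (isolated vertices count as components). *)

(* Defs.v *)
From HB Require Import structures.
From mathcomp Require Import all_boot all_order all_algebra.
From mathcomp Require Import all_classical all_reals all_analysis.

Set Implicit Arguments.
Unset Strict Implicit.
Unset Printing Implicit Defensive.

Import Order.TTheory GRing.Theory Num.Theory.
Import numFieldNormedType.Exports.

Local Open Scope classical_set_scope.
Local Open Scope ring_scope.

Definition homeomorphic (X Y : topologicalType) : Prop :=
  exists (f : X -> Y) (g : Y -> X),
    [/\ continuous f, continuous g, cancel f g & cancel g f].

(* Euclidean ball: the library norm on row vectors is the sup norm. *)
Definition unit_open_ball (R : realType) (d : nat) : set 'rV[R]_d :=
  [set x | \sum_(i < d) x 0 i ^+ 2 < 1].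
Arguments unit_open_ball : clear implicits.

(* A set coerces to the type of its elements, with the subspace topology. *)
Definition is_cell_of_dim (R : realType) (X : topologicalType) (S : set X)
    (d : nat) : Prop :=
  homeomorphic S (unit_open_ball R d).

Section Grassmannian.
Context (R : realType) (n : nat).

Definition Gr2 := {V : {vspace 'rV[R]_n} | \dim V == 2%N}.

Definition rank2 : set 'M[R]_(2, n) := [set A | \rank A = 2%N].

Definition row_span (A : 'M[R]_(2, n)) : {vspace 'rV[R]_n} :=
  span [:: row 0 A; row 1 A].

Lemma dim_row_span (A : rank2) : \dim (row_span (set_val A)) == 2%N.
Proof.
have rA : \rank (set_val A) = 2%N by exact: set_valP A.
move: (set_val A) rA => {}A rA; rewrite /row_span.
suff : free [:: row 0 A; row 1 A] by move=> /eqP ->.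
rewrite !free_cons span_seq1 span_nil nil_free memv0 !andbT /=.
have inj (u : 'rV_2) : u *m A = 0 -> u = 0.
  move=> uA; apply: (row_free_inj (A := A)); last by rewrite uA mul0mx.
  by rewrite /row_free rA.
have mulE (u : 'rV_2) : u *m A = u 0 0 *: row 0 A + u 0 1 *: row 1 A.
  rewrite mulmx_sum_row !big_ord_recl big_ord0 addr0.
  by rewrite (_ : lift ord0 ord0 = 1) //; exact: val_inj.
apply/andP; split.
  apply/negP => /vlineP[k rowk].
  have /inj/rowP/(_ 0) : (\row_(j < 2) (if j == 0 then 1 else - k)) *m A = 0.
    by rewrite mulE !mxE /= scale1r rowk scaleNr subrr.
  by rewrite !mxE /= => /eqP; rewrite oner_eq0.
apply/eqP => row0.
have /inj/rowP/(_ 1) : (\row_(j < 2) (j == 1)%:R) *m A = 0.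
  by rewrite mulE !mxE /= scale0r row0 scaler0 addr0.
by rewrite !mxE /= => /eqP; rewrite oner_eq0.
Qed.

Definition Gr2_of (A : rank2) : Gr2 :=
  exist (fun V : {vspace _} => \dim V == 2%N) _ (dim_row_span A).

HB.instance Definition _ := Choice.on Gr2.

(* The quotient topology along [Gr2_of]. *)
Definition Gr2_open (U : set Gr2) : Prop := open (Gr2_of @^-1` U).

Lemma Gr2_openT : Gr2_open setT.
Proof. by rewrite /Gr2_open preimage_setT; exact: openT. Qed.

Lemma Gr2_openI : setI_closed Gr2_open.
Proof. by move=> U V oU oV; rewrite /Gr2_open preimage_setI; exact: openI. Qed.

Lemma Gr2_open_bigU (I : Type) (f : I -> set Gr2) :
  (forall i, Gr2_open (f i)) -> Gr2_open (\bigcup_i f i).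
Proof.
move=> opf; rewrite /Gr2_open preimage_bigcup.
by apply: bigcup_open => i _; exact: opf.
Qed.

HB.instance Definition _ :=
  isOpenTopological.Build Gr2 Gr2_openT Gr2_openI Gr2_open_bigU.

End Grassmannian.

Arguments rank2 : clear implicits.

Section Positroid.
Context (R : realType) (n : nat).

Definition pairs : {set {set 'I_n}} := [set e : {set 'I_n} | #|e| == 2%N]%SET.

Definition minor2 (A : 'M[R]_(2, n)) (i j : 'I_n) : R :=
  \det (colsub (tnth [tuple i; j]) A).

Definition Gr2_ge0 : set (Gr2 R n) :=
  [set V | exists A : rank2 R n, Gr2_of A = V /\
     forall i j : 'I_n, (i < j)%N -> 0 <= minor2 (set_val A) i j].

Definition S_plus (I : {set {set 'I_n}}) : set (Gr2 R n) :=
  [set V | Gr2_ge0 V /\ exists A : rank2 R n, Gr2_of A = V /\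
     forall i j : 'I_n, (i < j)%N ->
       ([set i; j]%SET \in I -> 0 < minor2 (set_val A) i j) /\
       ([set i; j]%SET \notin I -> minor2 (set_val A) i j = 0)].

Definition positroid (I : {set {set 'I_n}}) : Prop :=
  [/\ I \subset pairs, I != finset.set0 & S_plus I !=set0].

End Positroid.

Arguments S_plus R {n} I : rename.
Arguments positroid R {n} I : rename.

Section Graph.
Context (n : nat) (D : {set {set 'I_n}}).

Definition T_set : {set 'I_n} :=
  [set i : 'I_n | [forall j, (j != i) ==> ([set i; j]%SET \in D)]]%SET.

Definition G_vertices : {set 'I_n} := (~: T_set)%SET.

Definition G_edge : rel 'I_n := [rel i j |
  [&& i != j, [set i; j]%SET \in D, i \in G_vertices & j \in G_vertices]].

Definition num_components : nat := n_comp G_edge G_vertices.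

End Graph.

(* Main.v *)
Require Import Defs.
From mathcomp Require Import all_boot all_order all_algebra.
From mathcomp Require Import all_classical all_reals all_analysis.
From mathcomp Require Import ring lra zify.

(** Let [a] be the first non-loop and [b] the first index not parallel to [a].
    Normalizing columns [a] and [b] to the identity matrix turns a point of the
    cell into columns [(x_j, y_j)], whose entries are ratios of Plücker
    coordinates. A non-loop [j] parallel to [a] has [y_j = 0] and [x_j] of a sign
    forced by its position relative to [b]. For the other non-loops [y_j > 0], and
    since [p_ij = y_i y_j (s_i - s_j)] up to scaling, the slopes
    [s_j = x_j / y_j] decrease weakly from [s_b = 0], dropping strictly exactly at
    the first index of each further parallel class. The logarithms of the
    [n - |T| - 2] free scales and of the [c - 2] drops are therefore arbitrary real
    numbers, and they give a homeomorphism from the cell to a Euclidean space. *)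

Set Implicit Arguments.
Unset Strict Implicit.
Unset Printing Implicit Defensive.

Import Order.TTheory GRing.Theory Num.Theory.
Import numFieldNormedType.Exports.

Local Open Scope classical_set_scope.
Local Open Scope ring_scope.

(** * Continuity and the open ball *)

(** Neighbourhoods of a matrix are generated by products of neighbourhoods of its entries, and
    finitely many conditions hold near [x] simultaneously. *)
Lemma continuous_mx (X T : topologicalType) (m n : nat) (f : X -> 'M[T]_(m, n))
    (x : X) :
  (forall i j, {for x, continuous (fun y => f y i j)}) -> {for x, continuous f}.
Proof.
move=> fc A [P fP sPA].
have : \forall y \near x, forall ij : 'I_m * 'I_n, P ij.1 ij.2 (f y ij.1 ij.2).
  by apply: filter_forall => -[i j]; exact: fc (fP i j).
by apply: filterS => y Py; apply: sPA => i j; exact: (Py (i, j)).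
Qed.

Lemma continuous_set_type (X Y : topologicalType) (A : set Y) (f : X -> A) :
  continuous (set_val \o f) -> continuous f.
Proof. exact: continuous_comp_initial. Qed.

Lemma eq_continuous_for (X Y : topologicalType) (f g : X -> Y) (x : X) :
  f =1 g -> {for x, continuous f} -> {for x, continuous g}.
Proof. by move=> /funext ->. Qed.

Lemma homeomorphic_trans (X Y Z : topologicalType) :
  homeomorphic X Y -> homeomorphic Y Z -> homeomorphic X Z.
Proof.
move=> [f [f' [fc f'c fK f'K]]] [g [g' [gc g'c gK g'K]]].
exists (g \o f), (f' \o g'); split.
- by move=> x; apply: continuous_comp; [exact: fc|exact: gc].
- by move=> x; apply: continuous_comp; [exact: g'c|exact: f'c].
- exact: can_comp.
- exact: can_comp.
Qed.

Lemma continuous_sum (R : realType) (X : topologicalType) (I : Type) (r : seq I)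
    (P : pred I) (f : I -> X -> R) (x : X) :
  (forall i, P i -> {for x, continuous (f i)}) ->
  {for x, continuous (fun y => \sum_(i <- r | P i) f i y)}.
Proof. by move=> fc; apply: cvg_big => //; exact: add_continuous. Qed.

(* Eta-expanded forms of the library's lemmas on [f \+ g], [f \- g], ...: these
   unify with functions given by an explicit body. *)
Section RealContinuity.
Context (R : realType) (X : topologicalType).
Implicit Types (f g : X -> R) (x : X).

Lemma continuous_addf f g x : {for x, continuous f} -> {for x, continuous g} ->
  {for x, continuous (fun y => f y + g y)}.
Proof. exact: continuousD. Qed.

Lemma continuous_subf f g x : {for x, continuous f} -> {for x, continuous g} ->
  {for x, continuous (fun y => f y - g y)}.
Proof. exact: continuousB. Qed.

Lemma continuous_mulf f g x : {for x, continuous f} -> {for x, continuous g} ->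
  {for x, continuous (fun y => f y * g y)}.
Proof. exact: continuousM. Qed.

Lemma continuous_invf f x : f x != 0 -> {for x, continuous f} ->
  {for x, continuous (fun y => (f y)^-1)}.
Proof. exact: continuousV. Qed.

End RealContinuity.

Section Ball.
Context (R : realType) (d : nat).
Implicit Types x : 'rV[R]_d.

Definition sqnorm x : R := \sum_(i < d) x 0 i ^+ 2.

Lemma sqnorm_ge0 x : 0 <= sqnorm x.
Proof. by apply: sumr_ge0 => i _; exact: sqr_ge0. Qed.

Lemma sqnormZ (k : R) x : sqnorm (k *: x) = k ^+ 2 * sqnorm x.
Proof. by rewrite /sqnorm mulr_sumr; apply: eq_bigr => i _; rewrite mxE exprMn. Qed.

Lemma sqnorm_continuous : continuous sqnorm.
Proof.
move=> x; apply: continuous_sum => i _.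
apply: (@continuous_mulf _ _ (fun x => x 0 i) (fun x => x 0 i)); exact: coord_continuous.
Qed.

Definition into_ball x : 'rV[R]_d := (Num.sqrt (1 + sqnorm x))^-1 *: x.
Definition from_ball x : 'rV[R]_d := (Num.sqrt (1 - sqnorm x))^-1 *: x.

Lemma sqnorm_into_ball x : sqnorm (into_ball x) = sqnorm x / (1 + sqnorm x).
Proof.
have := sqnorm_ge0 x => x0.
by rewrite sqnormZ exprVn sqr_sqrtr 1?mulrC// addr_ge0.
Qed.

Lemma into_ball_subproof x : into_ball x \in unit_open_ball R d.
Proof.
rewrite inE /unit_open_ball /= -/(sqnorm _) sqnorm_into_ball.
have := sqnorm_ge0 x => x0.
by rewrite ltr_pdivrMr ?mul1r ?ltrDr; lra.
Qed.

Lemma continuous_scalef (X : topologicalType) (k : X -> R) (f : X -> 'rV[R]_d) (x : X) :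
  {for x, continuous k} -> {for x, continuous f} ->
  {for x, continuous (fun y => k y *: f y)}.
Proof. by move=> kc fc; exact: cvgZ. Qed.

(** The two radial maps invert each other because [1 - sqnorm (into_ball x)] is the inverse of
    [1 + sqnorm x], and likewise in the other direction. *)
Lemma homeomorphic_ball : homeomorphic 'rV[R]_d (unit_open_ball R d).
Proof.
pose f x : unit_open_ball R d := SigSub (into_ball_subproof x).
pose g (y : unit_open_ball R d) := from_ball (set_val y).
exists f, g; split.
- apply: continuous_set_type => x.
  apply: (@continuous_scalef _ (fun x => (Num.sqrt (1 + sqnorm x))^-1) id);
    last exact: cvg_id.
  have x0 := sqnorm_ge0 x.
  apply: (@continuous_invf _ _ (fun x => Num.sqrt (1 + sqnorm x))).
    by rewrite gt_eqF// sqrtr_gt0; lra.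
  apply: (@continuous_comp _ _ _ (fun x => 1 + sqnorm x) Num.sqrt);
    last exact: sqrt_continuous.
  by apply: (@continuous_addf _ _ (fun=> 1) sqnorm);
    [exact: cst_continuous|exact: sqnorm_continuous].
- move=> y; have : sqnorm (set_val y) < 1 := set_valP y => y1.
  have yc : {for y, continuous (set_val : unit_open_ball R d -> _)}.
    exact: initial_continuous.
  apply: (@continuous_scalef _ (fun y : unit_open_ball R d =>
    (Num.sqrt (1 - sqnorm (set_val y)))^-1) set_val); last exact: yc.
  apply: (@continuous_invf _ _ (fun y : unit_open_ball R d =>
    Num.sqrt (1 - sqnorm (set_val y)))).
    by rewrite gt_eqF// sqrtr_gt0; lra.
  apply: (@continuous_comp _ _ _ (fun y : unit_open_ball R d => 1 - sqnorm (set_val y))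
    Num.sqrt); last exact: sqrt_continuous.
  apply: (@continuous_subf _ _ (fun=> 1) (sqnorm \o set_val)); first exact: cst_continuous.
  by apply: (@continuous_comp _ _ _ set_val sqnorm); [exact: yc|exact: sqnorm_continuous].
- move=> x; rewrite /g /f /from_ball /= /into_ball.
  have x0 := sqnorm_ge0 x.
  rewrite scalerA set_valE /= -/(into_ball x) sqnorm_into_ball.
  rewrite (_ : 1 - _ = (1 + sqnorm x)^-1); last by field; lra.
  rewrite sqrtrV; last lra.
  by rewrite invrK divff ?scale1r// gt_eqF// sqrtr_gt0; lra.
- move=> y; apply: val_inj => /=; rewrite /g /from_ball.
  have : sqnorm (set_val y) < 1 := set_valP y => y1.
  set v := set_val y in y1 *; rewrite -set_valE -/v.
  rewrite {1}/into_ball scalerA sqnormZ exprVn sqr_sqrtr; last lra.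
  have -> : 1 + (1 - sqnorm v)^-1 * sqnorm v = (1 - sqnorm v)^-1 by field; lra.
  rewrite sqrtrV; last lra.
  by rewrite invrK divff ?scale1r// gt_eqF// sqrtr_gt0; lra.
Qed.

End Ball.

(** * Ratios of Plücker coordinates *)

Section Plucker.
Context (R : realType) (n : nat).
Implicit Types (A B : 'M[R]_(2, n)) (i j a b : 'I_n) (V : Gr2 R n).

Lemma lift0_I2 : lift ord0 ord0 = 1 :> 'I_2.
Proof. exact: val_inj. Qed.

Lemma minor2E A i j : minor2 A i j = A 0 i * A 1 j - A 0 j * A 1 i.
Proof.
rewrite /minor2 (expand_det_row _ 0) !big_ord_recl big_ord0 addr0 /cofactor.
rewrite !det_mx11 !mxE !(tnth_nth i) /= lift0_I2; ring.
Qed.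

Lemma minor2_mulmx (P : 'M[R]_2) A i j : minor2 (P *m A) i j = \det P * minor2 A i j.
Proof. by rewrite /minor2 -det_mulmx mulmx_colsub. Qed.

Lemma rank2_minor2 A i j : minor2 A i j != 0 -> rank2 R n A.
Proof.
move=> m0; apply/eqP; rewrite eqn_leq rank_leq_row /=.
have : \rank (colsub (tnth [tuple i; j]) A) = 2%N.
  by apply/eqP; rewrite -[_ == _]/(row_free _) row_free_unit unitmxE unitfE.
by move=> {1}<-; rewrite -[X in colsub _ X]mulmx1 -mulmx_colsub mxrankM_maxl.
Qed.

Lemma mem_row_span A (u : 'rV[R]_2) : u *m A \in row_span A.
Proof.
rewrite mulmx_sum_row !big_ord_recl big_ord0 addr0.
by rewrite lift0_I2 rpredD// rpredZ// memv_span// !inE eqxx ?orbT.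
Qed.

Lemma row_span_mem A (v : 'rV[R]_n) : v \in row_span A -> exists u : 'rV[R]_2, v = u *m A.
Proof.
rewrite /row_span span_cons span_seq1 => /memv_addP[_ /vlineP[k ->]] [_ /vlineP[l ->] ->].
exists (\row_(i < 2) if i == 0 then k else l).
by rewrite mulmx_sum_row !big_ord_recl big_ord0 addr0 !mxE /= lift0_I2.
Qed.

Lemma row_span_mulmx (P : 'M[R]_2) A : (row_span (P *m A) <= row_span A)%VS.
Proof.
by apply/span_subvP => v; rewrite !inE => /orP[]/eqP->; rewrite row_mul mem_row_span.
Qed.

Lemma Gr2_of_mulmx (P : 'M[R]_2) (A B : rank2 R n) :
  set_val A = P *m set_val B -> Gr2_of A = Gr2_of B.
Proof.
move=> AB; apply: val_inj; apply/eqP; rewrite /= eqEdim.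
rewrite (eqP (dim_row_span A)) (eqP (dim_row_span B)) leqnn andbT AB.
exact: row_span_mulmx.
Qed.

(** The rows of [A] are combinations of the rows of [B]; the coefficient matrix is invertible
    because its rank is at least that of [A]. *)
Lemma Gr2_of_eq (A B : rank2 R n) : Gr2_of A = Gr2_of B ->
  exists2 P : 'M[R]_2, \det P != 0 & set_val A = P *m set_val B.
Proof.
move=> /(congr1 val) /= AB.
have rowA (i : 'I_2) : exists u : 'rV[R]_2, row i (set_val A) = u *m set_val B.
  apply: row_span_mem; rewrite -AB memv_span// !inE.
  by case: i => [[|[|//]]] p; [rewrite (_ : Ordinal p = 0)|rewrite (_ : Ordinal p = 1)];
    rewrite ?eqxx ?orbT//; exact: val_inj.
have [u uP] := choice rowA.
exists (\matrix_i u i).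
  rewrite -unitfE -unitmxE -row_free_unit -row_leq_rank.
  have rA : \rank (set_val A) = 2%N := set_valP A.
  rewrite -{1}rA (_ : set_val A = (\matrix_i u i) *m set_val B) ?mxrankM_maxl//.
  by apply/row_matrixP => i; rewrite row_mul rowK uP.
by apply/row_matrixP => i; rewrite row_mul rowK uP.
Qed.

(* An arbitrary matrix representing [V]; the junk value [0] is never reached
   since every plane has a basis. *)
Definition repr_mx V : 'M[R]_(2, n) :=
  xget 0 [set A | exists A' : rank2 R n, Gr2_of A' = V /\ set_val A' = A].

Definition plucker_ratio a b i j V : R :=
  minor2 (repr_mx V) i j / minor2 (repr_mx V) a b.

Lemma repr_mxP (A : rank2 R n) :
  exists2 P : 'M[R]_2, \det P != 0 & repr_mx (Gr2_of A) = P *m set_val A.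
Proof.
rewrite /repr_mx; case: xgetP => [B _ [B' [B'A <-]]|]; first exact: Gr2_of_eq.
by move=> /(_ (set_val A)) []; exists A.
Qed.

(** Changing the representative multiplies both minors by the same nonzero determinant, so the
    choice made by [repr_mx] does not affect the ratio. *)
Lemma plucker_ratioE a b i j (A : rank2 R n) :
  plucker_ratio a b i j (Gr2_of A) = minor2 (set_val A) i j / minor2 (set_val A) a b.
Proof.
have [P P0 AP] := repr_mxP A.
by rewrite /plucker_ratio AP !minor2_mulmx -mulf_div divff ?mul1r.
Qed.

Lemma minor2_continuous i j : continuous (fun A => minor2 A i j).
Proof.
move=> A; rewrite (_ : (fun A => _) = (fun A => A 0 i * A 1 j - A 0 j * A 1 i)); last first.
  by apply/funext => B; rewrite minor2E.
apply: (@continuous_subf _ _ (fun A => A 0 i * A 1 j) (fun A => A 0 j * A 1 i)).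
  apply: (@continuous_mulf _ _ (fun A => A 0 i) (fun A => A 1 j)); exact: coord_continuous.
apply: (@continuous_mulf _ _ (fun A => A 0 j) (fun A => A 1 i)); exact: coord_continuous.
Qed.

Lemma Gr2_of_continuous : continuous (@Gr2_of R n).
Proof. by apply/continuousP. Qed.

(** The choice [repr_mx] need not be continuous, so the argument takes place upstairs: a set of
    planes is open when its preimage among matrices is, and there the ratio is a quotient of
    polynomials in the entries. *)
Lemma plucker_ratio_continuous a b i j (A : rank2 R n) :
  minor2 (set_val A) a b != 0 ->
  {for Gr2_of A, continuous (plucker_ratio a b i j)}.
Proof.
move=> mA U; rewrite nbhsE => -[G [oG GA] sGU].
pose m (p q : 'I_n) (B : rank2 R n) : R := minor2 (set_val B) p q.
have mc p q : continuous (m p q).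
  move=> B; apply: (@continuous_comp _ _ _ set_val (fun A => minor2 A p q)).
    exact: initial_continuous.
  exact: minor2_continuous.
pose W := [set V | (exists B : rank2 R n, V = Gr2_of B /\ m a b B != 0) /\
   G (plucker_ratio a b i j V)].
have oW : open W.
  rewrite -[open W]/(open (@Gr2_of R n @^-1` W)) openE => B.
  move=> [[B' [B'B mB']] GB].
  (* The minor is known to be nonzero for some matrix with the same row span; a change of basis
     transfers this to [B]. *)
  have mB : m a b B != 0.
    have [P P0 e] := Gr2_of_eq B'B.
    by rewrite /m e minor2_mulmx mulf_neq0.
  rewrite /= plucker_ratioE in GB.
  have nO : \forall C \near B, G (m i j C / m a b C).
    have cB : {for B, continuous (fun C => m i j C / m a b C)}.
      by apply: continuous_mulf; [exact: mc|apply: continuous_invf => //; exact: mc].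
    by apply: cB; exact: open_nbhs_nbhs.
  have n0 : \forall C \near B, m a b C != 0.
    by apply: (mc a b B [set x | x != 0]); apply: open_nbhs_nbhs; split => //; exact: open_neq.
  rewrite /interior; near=> C; split.
    by exists C; split => //; near: C.
  by rewrite /= plucker_ratioE; near: C.
have WA : W (Gr2_of A) by split => //; exists A.
apply: (@filterS _ _ _ W); last exact: open_nbhs_nbhs.
by move=> V [_ GV]; exact: sGU.
Unshelve. all: by end_near. Qed.

End Plucker.

(** * Sign patterns of realizable matrices *)

Section Realization.
Context (R : realType) (n : nat) (D : {set {set 'I_n}}).
Implicit Types (A : 'M[R]_(2, n)) (i j k a b : 'I_n).

(* For non-loops: columns [i] and [j] are parallel. *)
Definition dep i j : bool := [set i; j]%SET \in D.

Lemma depC i j : dep i j = dep j i.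
Proof. by rewrite /dep finset.setUC. Qed.

Definition realizes A : Prop := forall i j, (i < j)%N ->
  (~~ dep i j -> 0 < minor2 A i j) /\ (dep i j -> minor2 A i j = 0).

(** The sign conditions already make every minor of the representative nonnegative, so the same
    matrix witnesses membership in [Gr2_ge0]. *)
Lemma S_plusP (V : Gr2 R n) : S_plus R (pairs n :\: D)%SET V <->
  exists A : rank2 R n, Gr2_of A = V /\ realizes (set_val A).
Proof.
have ijE i j : (i < j)%N -> ([set i; j]%SET \in (pairs n :\: D)%SET) = ~~ dep i j.
  by move=> ij; rewrite !inE cards2 neq_ltn ij andbT.
split=> [[_ [A [AV rA]]]|[A [AV rA]]].
  by exists A; split=> // i j ij; have := rA _ _ ij; rewrite ijE// negbK.
split; exists A; split=> // i j ij; have [pos zero] := rA _ _ ij.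
  by case: (boolP (dep i j)) => [/zero ->//|/pos/ltW].
by rewrite ijE// negbK.
Qed.

Lemma loopP i : reflect (forall j, j != i -> dep i j) (i \in T_set D).
Proof.
by rewrite inE; apply: (iffP forallP) => h j; [have /implyP := h j|apply/implyP; exact: h].
Qed.

Section Frame.
Context (a b : 'I_n).

(** In a realizing matrix these are the columns with nonzero second coordinate in the basis of
    columns [a] and [b]. The complement contains [a], the columns parallel to it, and the loops. *)
Definition transverse j : bool := (j != a) && ~~ dep a j.

Record frame : Prop := Frame {
  frame_a : a \notin T_set D;
  frame_min : forall i, i \notin T_set D -> (a <= i)%N;
  frame_b : transverse b;
  frame_bmin : forall j, transverse j -> (b <= j)%N }.

Hypothesis ab : frame.

Lemma transverse_nloop j : transverse j -> j \notin T_set D.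
Proof.
move=> /andP[ja]; rewrite depC; apply: contra => /loopP; apply.
by rewrite eq_sym.
Qed.

Lemma frame_lt j : transverse j -> (a < j)%N.
Proof.
move=> Yj; have := frame_min ab (transverse_nloop Yj).
by rewrite leq_eqVlt => /predU1P[/val_inj aj|//]; move: Yj; rewrite /transverse aj eqxx.
Qed.

Lemma transverse_a : transverse a = false.
Proof. by rewrite /transverse eqxx. Qed.

(** * Coordinates and slopes of the columns of a realizing matrix *)

Section Columns.
Context (A : 'M[R]_(2, n)).
Hypothesis rA : realizes A.

(** Cramer's rule for the coordinates of column [j] in the basis of columns [a] and [b]. *)
Definition xcoord j : R := minor2 A j b / minor2 A a b.
Definition ycoord j : R := minor2 A a j / minor2 A a b.
Definition slope j : R := xcoord j / ycoord j.

Lemma minor2C i j : minor2 A i j = - minor2 A j i.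
Proof. by rewrite !minor2E; ring. Qed.

Lemma minor2_eq0 i j : i != j -> (minor2 A i j == 0) = dep i j.
Proof.
wlog ij : i j / (i < j)%N => [th|_].
  move=> ij; case: (ltngtP i j) => [| |/val_inj e]; first by move/th; apply.
    by move/th; rewrite minor2C oppr_eq0 depC eq_sym; apply.
  by rewrite e eqxx in ij.
have [pos zero] := rA ij.
by case: (boolP (dep i j)) => [/zero ->|/pos p]; rewrite ?eqxx// gt_eqF.
Qed.

Lemma minor2_ge0 i j : (i < j)%N -> 0 <= minor2 A i j.
Proof.
move=> ij; have [pos zero] := rA ij.
by case: (boolP (dep i j)) => [/zero ->//|/pos/ltW].
Qed.

Lemma minor2_frame_gt0 : 0 < minor2 A a b.
Proof.
have Yb := frame_b ab; apply: (rA (frame_lt Yb)).1.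
by case/andP: Yb.
Qed.

Lemma minor2_frame_neq0 : minor2 A a b != 0.
Proof. by rewrite gt_eqF// minor2_frame_gt0. Qed.

(** This is the three-term relation [p_ij p_ab = p_ib p_aj - p_jb p_ai], divided by the square of
    [p_ab]. *)
Lemma plucker_relation i j :
  minor2 A i j / minor2 A a b = xcoord i * ycoord j - xcoord j * ycoord i.
Proof.
have := minor2_frame_neq0; rewrite /xcoord /ycoord !minor2E => p0.
by field.
Qed.

Lemma cross_eq0 i j : i != j ->
  (xcoord i * ycoord j - xcoord j * ycoord i == 0) = dep i j.
Proof.
move=> ij; rewrite -plucker_relation -minor2_eq0// mulf_eq0 invr_eq0.
by rewrite (negbTE minor2_frame_neq0) orbF.
Qed.

Lemma ycoord_gt0 j : transverse j -> 0 < ycoord j.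
Proof.
move=> Yj; apply: divr_gt0; last exact: minor2_frame_gt0.
by apply: (rA (frame_lt Yj)).1; case/andP: Yj.
Qed.

Lemma ycoord_eq0 j : ~~ transverse j -> ycoord j = 0.
Proof.
rewrite negb_and !negbK => /predU1P[->|]; first by rewrite /ycoord minor2E subrr mul0r.
have [<-|ja] := eqVneq a j; first by rewrite /ycoord minor2E subrr mul0r.
by rewrite -minor2_eq0 // /ycoord => /eqP ->; rewrite mul0r.
Qed.

Lemma loop_coord0 j : j \in T_set D -> xcoord j = 0 /\ ycoord j = 0.
Proof.
move=> Tj; split; last first.
  by apply: ycoord_eq0; apply: contraL Tj; exact: transverse_nloop.
have jb : j != b.
  by apply: contraTneq Tj => ->; apply: transverse_nloop; exact: frame_b ab.
have /loopP/(_ b) := Tj; rewrite eq_sym jb => /(_ isT).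
by rewrite -minor2_eq0// /xcoord => /eqP ->; rewrite mul0r.
Qed.

(** Since [y_i = 0], a vanishing [x_i] would make the whole column zero and [i] a loop. *)
Lemma xcoord_neq0 i : i \notin T_set D -> ~~ transverse i -> xcoord i != 0.
Proof.
move=> Ti Yi; apply: contraNneq Ti => x0; apply/loopP => j; rewrite eq_sym => ij.
by rewrite -cross_eq0// x0 (ycoord_eq0 Yi) !mulr0 mul0r subrr.
Qed.

Lemma xcoord_gt0 i : i \notin T_set D -> ~~ transverse i -> (i < b)%N -> 0 < xcoord i.
Proof.
move=> Ti Yi ib; rewrite lt0r xcoord_neq0//=; apply: divr_ge0.
  exact: minor2_ge0.
exact/ltW/minor2_frame_gt0.
Qed.

Lemma xcoord_lt0 i : i \notin T_set D -> ~~ transverse i -> (b < i)%N -> xcoord i < 0.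
Proof.
move=> Ti Yi bi; rewrite lt_neqAle xcoord_neq0//= /xcoord minor2C mulNr oppr_le0.
by apply: divr_ge0; [exact: minor2_ge0|exact/ltW/minor2_frame_gt0].
Qed.

Lemma nontransverse_dep i j : ~~ transverse i -> ~~ transverse j -> i != j -> dep i j.
Proof.
move=> Yi Yj ij; by rewrite -cross_eq0// !ycoord_eq0// !mulr0 subrr.
Qed.

Lemma neq_transverse i j : ~~ transverse i -> transverse j -> i != j.
Proof. by move=> Yi Yj; apply: contraNneq Yi => ->. Qed.

Lemma transverse_ndep i j : i \notin T_set D -> ~~ transverse i -> transverse j ->
  ~~ dep i j.
Proof.
move=> Ti Yi Yj; rewrite -cross_eq0 ?neq_transverse// (ycoord_eq0 Yi) mulr0 subr0.
by rewrite mulf_neq0 ?xcoord_neq0// gt_eqF// ycoord_gt0.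
Qed.

(** Here [y_i = 0] and [x_i < 0 < y_j], so [i < j] would make [p_ij / p_ab = x_i y_j] negative. *)
Lemma transverse_lt i j : i \notin T_set D -> ~~ transverse i -> transverse j ->
  (b < i)%N -> (j < i)%N.
Proof.
move=> Ti Yi Yj bi; case: (ltngtP i j) => // [ij|/val_inj e]; last first.
  by move: (neq_transverse Yi Yj); rewrite e eqxx.
have : 0 <= minor2 A i j / minor2 A a b.
  by apply: divr_ge0; [exact: minor2_ge0|exact/ltW/minor2_frame_gt0].
rewrite plucker_relation (ycoord_eq0 Yi) mulr0 subr0 leNgt.
by rewrite nmulr_rlt0 ?ycoord_gt0// xcoord_lt0.
Qed.

Lemma slope_minor2 i j : transverse i -> transverse j ->
  slope i - slope j = minor2 A i j / minor2 A a b / (ycoord i * ycoord j).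
Proof.
move=> Yi Yj; rewrite plucker_relation /slope.
by have := ycoord_gt0 Yi; have := ycoord_gt0 Yj => yi yj; field; lra.
Qed.

Lemma slope_eq i j : transverse i -> transverse j -> i != j ->
  (slope i == slope j) = dep i j.
Proof.
move=> Yi Yj ij; rewrite -minor2_eq0// -subr_eq0 slope_minor2//.
rewrite !mulf_eq0 !invr_eq0 mulf_eq0 (negbTE minor2_frame_neq0).
by rewrite !(gt_eqF (ycoord_gt0 _))// !orbF.
Qed.

Lemma slope_le i j : transverse i -> transverse j -> (i <= j)%N -> slope j <= slope i.
Proof.
move=> Yi Yj; rewrite leq_eqVlt => /predU1P[/val_inj->//|ij].
rewrite -subr_ge0 slope_minor2//; apply: divr_ge0.
  by apply: divr_ge0; [exact: minor2_ge0|exact/ltW/minor2_frame_gt0].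
by apply/ltW/mulr_gt0; exact: ycoord_gt0.
Qed.

Lemma slope_b : slope b = 0.
Proof. by rewrite /slope /xcoord minor2E subrr !mul0r. Qed.

End Columns.

(* The first indices of the parallel classes other than those of [a] and [b]. *)
Definition leaders : {set 'I_n} := [set k : 'I_n | [&& transverse k, k != b &
  [forall i : 'I_n, transverse i && (i < k)%N ==> ~~ dep i k]]]%SET.

Lemma leadersP k : reflect
  [/\ transverse k, k != b & forall i, transverse i -> (i < k)%N -> ~~ dep i k]
  (k \in leaders).
Proof.
rewrite inE; apply: (iffP and3P) => -[Yk kb h]; split => //.
  by move=> i Yi ik; have /forallP/(_ i) := h; rewrite Yi ik.
by apply/forallP => i; apply/implyP => /andP[]; exact: h.
Qed.

Definition no_leader i j := forall k, k \in leaders -> ~~ (i < k <= j)%N.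

(* All that realizability by some matrix imposes on [D]: the classes are consecutive
   among the non-loops, up to a wrap-around of the class of [a]. *)
Record blocks : Prop := Blocks {
  blocks_near i j : ~~ transverse i -> ~~ transverse j -> i != j -> dep i j;
  blocks_far i j : i \notin T_set D -> ~~ transverse i -> transverse j -> ~~ dep i j;
  blocks_lt i j : i \notin T_set D -> ~~ transverse i -> transverse j ->
    (b < i)%N -> (j < i)%N;
  blocks_dep i j : transverse i -> transverse j -> (i < j)%N -> dep i j -> no_leader i j;
  blocks_ndep i j : transverse i -> transverse j -> (i < j)%N -> ~~ dep i j ->
    exists2 k, k \in leaders & (i < k <= j)%N }.

Lemma realizes_blocks A : realizes A -> blocks.
Proof.
move=> rA; split.
- exact: (nontransverse_dep rA).
- exact: (transverse_ndep rA).
- exact: (transverse_lt rA).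
- move=> i j Yi Yj ij + k /leadersP[Yk kb kl].
  rewrite -(slope_eq rA)//; last by rewrite neq_ltn ij.
  move=> /eqP e; apply/negP => /andP[ik kj].
  (* Slopes decrease weakly along [i < k <= j] and agree at both ends, so [i] and [k] would be
     parallel although [k] is the first of its class. *)
  have := kl _ Yi ik; rewrite -(slope_eq rA)//; last by rewrite neq_ltn ik.
  rewrite eq_le (slope_le rA Yi Yk (ltnW ik)) andbT e.
  by rewrite (slope_le rA Yk Yj kj).
- move=> i j Yi Yj ij ndij.
  (* The required leader is the first transverse index in the class of [j]. It lies beyond [i],
     since otherwise the slope of [i] would be squeezed between the equal slopes of [k] and [j]. *)
  have := @arg_minnP _ j (fun k => transverse k && ((k == j) || dep k j)) val.
  rewrite Yj eqxx => /(_ isT); case=> k /andP[Yk kj] kmin.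
  have skj : slope A k = slope A j.
    have [->//|kj'] := eqVneq k j; apply/eqP.
    by rewrite (slope_eq rA)//; move: kj; rewrite (negbTE kj').
  have ik : (i < k)%N.
    rewrite ltnNge; apply: contra ndij => ki.
    rewrite -(slope_eq rA)//; last by rewrite neq_ltn ij.
    by rewrite eq_le -{1}skj (slope_le rA Yk Yi ki) (slope_le rA Yi Yj (ltnW ij)).
  exists k; last by rewrite ik /=; apply: kmin; rewrite Yj eqxx.
  apply/leadersP; split => //.
    by rewrite neq_ltn (leq_ltn_trans (frame_bmin ab Yi) ik) orbT.
  move=> l Yl lk; apply/negP; rewrite -(slope_eq rA)//; last by rewrite neq_ltn lk.
  move=> /eqP slk; have := kmin l; rewrite leqNgt /= lk => h.
  suff : false by []; apply: h; rewrite Yl/=.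
  by have [//|lj] := eqVneq l j; rewrite /= -(slope_eq rA)// slk skj.
Qed.

End Frame.

Lemma frame_exists : (pairs n :\: D)%SET != finset.set0 -> exists a b, frame a b.
Proof.
move=> /finset.set0Pn[e]; rewrite !inE => /andP[eD /cards2P[i [j [ij eE]]]].
have Ti : i \notin T_set D.
  apply/negP => /loopP/(_ j); rewrite eq_sym => /(_ ij).
  by rewrite /dep -eE (negbTE eD).
have := @arg_minnP _ i (fun k => k \notin T_set D) val Ti.
case=> a Ta amin.
have [k Yk] : exists k, transverse a k.
  have : ~~ [forall k, (k != a) ==> dep a k].
    by apply: contra Ta => /forallP h; apply/loopP => k; exact/implyP.
  by rewrite negb_forall => /existsP[k]; rewrite negb_imply; exists k.
have := @arg_minnP _ k (transverse a) val Yk.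
by case=> b Yb bmin; exists a, b.
Qed.

End Realization.

(** * Parallel classes *)

Section Components.
Context (R : realType) (n : nat) (D : {set {set 'I_n}}) (a b : 'I_n).
Context (A : 'M[R]_(2, n)).
Hypotheses (ab : frame D a b) (rA : realizes D A).

(** [None] is the infinite slope of the class of [a]. Loops receive it too, so labels identify
    classes only among non-loops. *)
Definition block_label (j : 'I_n) : option R :=
  if transverse D a j then Some (slope a b A j) else None.

Lemma dep_block_label i j : i \notin T_set D -> j \notin T_set D -> i != j ->
  dep D i j = (block_label i == block_label j).
Proof.
move=> Ti Tj ij; rewrite /block_label.
case: ifPn => Yi; case: ifPn => Yj.
- by rewrite -(slope_eq ab rA).
- by rewrite depC; apply/negbTE; apply: (transverse_ndep ab rA).
- by apply/negbTE; apply: (transverse_ndep ab rA).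
- by rewrite (nontransverse_dep ab rA).
Qed.

Lemma G_edgeE i j :
  G_edge D i j = [&& i != j, dep D i j, i \notin T_set D & j \notin T_set D].
Proof. by rewrite /G_edge /= !finset.in_setC. Qed.

(** Adjacency of distinct non-loops is equality of labels, hence transitive: every component is a
    clique and any path shortens to at most one edge. *)
Lemma G_connectP i j : i \notin T_set D ->
  reflect (j \notin T_set D /\ block_label i = block_label j) (connect (G_edge D) i j).
Proof.
move=> Ti; apply: (iffP idP) => [/connectP[p]|[Tj lij]]; last first.
  have [->|ij] := eqVneq i j; first exact: connect0.
  by apply: connect1; rewrite G_edgeE ij Ti Tj dep_block_label// lij eqxx.
elim: p i Ti => [i Ti _ -> //|k p IH i Ti /= /andP[]].
rewrite G_edgeE => /and4P[ik dik _ Tk] /(IH _ Tk) /[apply] -[Tj <-]; split => //.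
by apply/eqP; rewrite -dep_block_label.
Qed.

Lemma G_connect_sym : connect_sym (G_edge D).
Proof.
by apply: sym_connect_sym => i j; rewrite !G_edgeE depC eq_sym [X in _ && (_ && X)]andbC.
Qed.

(** The set formed by [a], [b] and the leaders meets each parallel class exactly once, so taking
    roots maps it bijectively onto the component roots. *)
Lemma num_componentsE : num_components D = (#|leaders D a b| + 2)%N.
Proof.
have Ya : ~~ transverse D a a by rewrite transverse_a.
have Yb := frame_b ab; have Tb := transverse_nloop Yb; have Ta := frame_a ab.
pose S := (a |: (b |: leaders D a b))%SET.
have nba : a != b by rewrite neq_ltn (frame_lt ab Yb).
have Sn i : i \in S -> i \notin T_set D.
  rewrite /S !finset.in_setU1 => /or3P[/eqP->//|/eqP->//|] /leadersP[Yi _ _].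
  exact: (transverse_nloop Yi).
have cS : #|S| = (#|leaders D a b| + 2)%N.
  rewrite !cardsU1 !finset.in_setU1 (negbTE nba) /=.
  have -> : a \in leaders D a b = false.
    by apply/negbTE/negP => /leadersP[]; rewrite (negbTE Ya).
  have -> : b \in leaders D a b = false.
    by apply/negbTE/negP => /leadersP[_]; rewrite eqxx.
  by rewrite addnA addnC.
have Sd i j : i \in S -> j \in S -> (i < j)%N -> ~~ dep D i j.
  move=> Si Sj ij.
  have bl k : k \in leaders D a b -> transverse D a k by case/leadersP.
  have jS : transverse D a i -> ~~ dep D i j.
    move=> Yi; move: Sj; rewrite /S !finset.in_setU1 => /or3P[/eqP ja|/eqP jb|].
    - by have := frame_lt ab Yi; rewrite -ja ltnNge ltnW.
    - by have := frame_bmin ab Yi; rewrite -jb leqNgt ij.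
    - by case/leadersP => _ _; apply.
  move: Si; rewrite /S !finset.in_setU1 => /or3P[/eqP ia|/eqP ib|/bl];
    [|by apply: jS; rewrite ib|exact: jS].
  move: Sj; rewrite /S !finset.in_setU1 => /or3P[/eqP ja|/eqP jb|/bl].
  - by rewrite ia ja ltnn in ij.
  - by rewrite ia jb; case/andP: Yb.
  - by rewrite ia => /andP[].
have Sinj : {in S &, injective (fingraph.root (G_edge D))}.
  have lt i j : i \in S -> j \in S -> (i < j)%N ->
      fingraph.root (G_edge D) i = fingraph.root (G_edge D) j -> False.
    move=> Si Sj ij rij; have := Sd _ _ Si Sj ij.
    rewrite dep_block_label ?Sn// ?neq_ltn ?ij// => /eqP; apply.
    have : connect (G_edge D) i j by rewrite -root_connect ?rij//; exact: G_connect_sym.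
    by move/(G_connectP _ (Sn _ Si)) => -[].
  move=> i j Si Sj rij; case: (ltngtP i j) => [ij|ji|/val_inj//].
    by case: (lt _ _ Si Sj ij).
  by case: (lt _ _ Sj Si ji).
have VE j : mem (G_vertices D) j = (j \notin T_set D).
  by rewrite -finset.in_setC.
rewrite -cS -(card_in_imset Sinj) /num_components /n_comp_mem.
apply: eq_card => r; rewrite inE; apply/andP/imsetP => [[rr Vr]|[i Si ->]]; last first.
  split; first exact: (roots_root G_connect_sym).
  rewrite VE; have : connect (G_edge D) i (fingraph.root (G_edge D) i) by exact: connect_root.
  by move/(G_connectP _ (Sn _ Si)) => -[].
rewrite VE in Vr.
(* Surjectivity: the class of [r] is that of [a], that of [b], or one whose first index is a
   leader. *)
suff [l Sl lr] : exists2 l, l \in S & block_label l = block_label r.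
  exists l => //; rewrite -(eqP rr); apply/(fingraph.rootP G_connect_sym).
  by rewrite G_connect_sym; apply/(G_connectP _ (Sn _ Sl)).
have [Yr|Yr] := boolP (transverse D a r); last first.
  exists a; first by rewrite !inE eqxx.
  by rewrite /block_label (negbTE Ya) (negbTE Yr).
have [br|rb] := boolP (dep D b r || (b == r)).
  exists b; first by rewrite !inE eqxx orbT.
  have [->//|nbr] := eqVneq b r; move: br; rewrite (negbTE nbr) orbF.
  by rewrite dep_block_label ?transverse_nloop// => /eqP.
have := @arg_minnP _ r (fun k => transverse D a k && ((k == r) || dep D k r)) val.
rewrite Yr eqxx => /(_ isT); case=> k /andP[Yk kr] kmin.
have lk : block_label k = block_label r.
  have [->//|nkr] := eqVneq k r; move: kr; rewrite (negbTE nkr) /=.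
  by rewrite dep_block_label ?(transverse_nloop Yk)// => /eqP.
have Tk := transverse_nloop Yk; exists k => //.
rewrite !finset.in_setU1; apply/or3P/Or33/leadersP; split => //.
  by apply: contra rb => /eqP kb; rewrite -kb orbC.
move=> i Yi ik; apply/negP; have Ti := transverse_nloop Yi; rewrite dep_block_label//; last first.
  by rewrite neq_ltn ik.
move=> /eqP lik; have := kmin i; rewrite leqNgt /= ik => h.
suff : false by []; apply: h; rewrite Yi/=.
by have [//|ir] := eqVneq i r; rewrite /= dep_block_label// lik lk.
Qed.

End Components.

(** * Parametrization of the cell *)

Section Parametrization.
Context (R : realType) (n : nat) (D : {set {set 'I_n}}) (a b : 'I_n).
Hypotheses (ab : frame D a b) (bl : blocks D a b).
Implicit Types (u t : 'I_n -> R) (i j k : 'I_n).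

Local Notation transverse := (transverse D a).
Local Notation leaders := (leaders D a b).

(** The default [b] is itself a candidate as soon as [j] is transverse and different from [b], so
    the maximum is then genuine. *)
Definition prev_transverse j : 'I_n :=
  arg_max b (fun i => transverse i && (i < j)%N) val.

Lemma prev_transverseP j : transverse j -> j != b ->
  [/\ transverse (prev_transverse j), (prev_transverse j < j)%N &
      forall i, transverse i -> (i < j)%N -> (i <= prev_transverse j)%N].
Proof.
move=> Yj jb; have Yb := frame_b ab.
have bj : transverse b && (b < j)%N.
  by rewrite Yb ltn_neqAle eq_sym jb (frame_bmin ab Yj).
rewrite /prev_transverse; case: arg_maxnP => //= p /andP[Yp pj] pmax; split => //.
by move=> i Yi ij; apply: pmax; rewrite Yi.
Qed.

Definition step_slope t j : R := - \sum_(k in leaders | (k <= j)%N) expR (t k).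

Lemma step_slopeB t i j : (i <= j)%N ->
  step_slope t i - step_slope t j = \sum_(k in leaders | (i < k <= j)%N) expR (t k).
Proof.
move=> ij; rewrite /step_slope opprK addrC.
rewrite (bigID (fun k : 'I_n => (k <= i)%N)) /= [X in X + _ - _ = _](_ : _ =
  \sum_(k in leaders | (k <= i)%N) expR (t k)); last first.
  by apply: eq_bigl => k; rewrite -andbA; congr (_ && _); lia.
rewrite addrAC subrr add0r; apply: eq_bigl => k.
by rewrite -andbA; congr (_ && _); lia.
Qed.

Lemma step_slope_b t : step_slope t b = 0.
Proof.
rewrite /step_slope big1 ?oppr0// => k /andP[/leadersP[Yk kb _]].
by rewrite leqNgt ltn_neqAle eq_sym kb (frame_bmin ab Yk).
Qed.

Lemma step_slope_const t i j : (i <= j)%N -> no_leader D a b i j ->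
  step_slope t i = step_slope t j.
Proof.
move=> ij nl; apply/eqP; rewrite -subr_eq0 step_slopeB// big1// => k /andP[lk].
by rewrite (negbTE (nl _ lk)).
Qed.

Lemma step_slope_lt t i j k : k \in leaders -> (i < k <= j)%N ->
  step_slope t j < step_slope t i.
Proof.
move=> lk ikj; have ij : (i <= j)%N by lia.
rewrite -subr_gt0 step_slopeB// (bigD1 k) ?lk//= ltr_wpDr ?expR_gt0//.
by apply: sumr_ge0 => l _; exact: expR_ge0.
Qed.

(** No transverse index lies strictly between [prev_transverse k] and [k], so the sum for this
    difference has the single term at [k]. *)
Lemma step_slope_leader t k : k \in leaders ->
  step_slope t (prev_transverse k) - step_slope t k = expR (t k).
Proof.
move=> lk; have /leadersP[Yk kb _] := lk.
have [Yp pk pmax] := prev_transverseP Yk kb.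
rewrite step_slopeB; last exact: ltnW.
rewrite (big_pred1 k)// => l /=; apply/andP/eqP => [[ll /andP[pl lk']]|->]; last first.
  by rewrite lk pk leqnn.
have /leadersP[Yl _ _] := ll; apply/val_inj/eqP; rewrite eqn_leq lk' /=.
by rewrite leqNgt; apply: contraTN pl => /(pmax _ Yl); rewrite leqNgt.
Qed.

(* Telescoping along the transverse indices: [s] only drops at leaders. *)
Lemma step_slopeE t (s : 'I_n -> R) : s b = 0 ->
  (forall i j, transverse i -> transverse j -> (i < j)%N -> dep D i j -> s i = s j) ->
  (forall k, k \in leaders -> expR (t k) = s (prev_transverse k) - s k) ->
  forall j, transverse j -> step_slope t j = s j.
Proof.
move=> sb sdep st j; elim: {j}(j : nat) {-2}j (leqnn j) => [|m IH] j jm Yj.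
  have -> : j = b by apply: val_inj => /=; have := frame_bmin ab Yj; lia.
  by rewrite step_slope_b sb.
have [->|jb] := eqVneq j b; first by rewrite step_slope_b sb.
have [Yp pj pmax] := prev_transverseP Yj jb.
have IHp : step_slope t (prev_transverse j) = s (prev_transverse j).
  by apply: IH => //; lia.
have [lj|nlj] := boolP (j \in leaders).
  by have := step_slope_leader t lj; rewrite st// IHp => /addrI/oppr_inj.
(* If these two were independent, [blocks_ndep] would give a leader after [prev_transverse j] and up
   to [j], which can only be [j]. *)
have dpj : dep D (prev_transverse j) j.
  apply: contraNT nlj => ndpj.
  have [k lk /andP[pk kj]] := blocks_ndep bl Yp Yj pj ndpj.
  have /leadersP[Yk _ _] := lk.
  have [<-//|kj'] := eqVneq k j.
  have := pmax k Yk; rewrite ltn_neqAle kj' kj => /(_ isT).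
  by rewrite leqNgt pk.
rewrite -(sdep _ _ Yp Yj pj dpj) -IHp; apply/esym/step_slope_const; first exact: ltnW.
exact: blocks_dep dpj.
Qed.

Definition side_sign j : R := if (j < b)%N then 1 else -1.

(** The number [expR (u j)] is the second coordinate of a transverse column, whose first coordinate
    is then slope times scale; for a non-loop parallel to [a] it is the absolute value of the first
    coordinate. *)
Definition param_x u t j : R :=
  if j \in T_set D then 0
  else expR (u j) * (if transverse j then step_slope t j else side_sign j).

Definition param_y u j : R := if transverse j then expR (u j) else 0.

Definition param_mx u t : 'M[R]_(2, n) :=
  \matrix_(r, j) if r == 0 then param_x u t j else param_y u j.

Lemma minor2_param u t i j :
  minor2 (param_mx u t) i j = param_x u t i * param_y u j - param_x u t j * param_y u i.
Proof. by rewrite minor2E !mxE. Qed.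

Lemma param_xa u t : u a = 0 -> param_x u t a = 1.
Proof.
move=> ua; rewrite /param_x (negbTE (frame_a ab)) ua expR0 mul1r transverse_a.
by rewrite /side_sign (frame_lt ab (frame_b ab)).
Qed.

Lemma param_ya u : param_y u a = 0.
Proof. by rewrite /param_y transverse_a. Qed.

Lemma param_xb u t : param_x u t b = 0.
Proof. by rewrite /param_x (frame_b ab) step_slope_b mulr0 if_same. Qed.

Lemma param_yb u : u b = 0 -> param_y u b = 1.
Proof. by rewrite /param_y (frame_b ab) => ->; rewrite expR0. Qed.

Lemma param_realizes u t : realizes D (param_mx u t).
Proof.
move=> i j ij; rewrite minor2_param.
have nij : i != j by rewrite neq_ltn ij.
have loop k : k \in T_set D -> param_x u t k = 0 /\ param_y u k = 0.
  move=> Tk; rewrite /param_x /param_y Tk; split => //.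
  by rewrite ifN//; apply: contraL Tk; exact: transverse_nloop.
have [Ti|Ti] := boolP (i \in T_set D).
  have [-> ->] := loop _ Ti; rewrite mul0r mulr0 subrr; split => //.
  by have /loopP/(_ j) := Ti; rewrite eq_sym => /(_ nij) ->.
have [Tj|Tj] := boolP (j \in T_set D).
  have [-> ->] := loop _ Tj; rewrite mul0r mulr0 subrr; split => //.
  by have /loopP/(_ i nij) := Tj; rewrite depC => ->.
rewrite /param_x /param_y (negbTE Ti) (negbTE Tj).
have ui := expR_gt0 (u i); have uj := expR_gt0 (u j).
have [Yi|Yi] := boolP (transverse i); have [Yj|Yj] := boolP (transverse j).
(* The minor is a positive multiple of a slope difference, which is positive or zero according to
   whether a leader lies in between. *)
- rewrite (_ : _ - _ = expR (u i) * expR (u j) * (step_slope t i - step_slope t j));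
    last by ring.
  split=> [ndij|dij].
    have [k lk ikj] := blocks_ndep bl Yi Yj ij ndij.
    by rewrite mulr_gt0 ?mulr_gt0// subr_gt0 (step_slope_lt t lk).
  rewrite (step_slope_const t (ltnW ij)) ?subrr ?mulr0//.
  exact: blocks_dep dij.
(* The index [j] comes after [i], hence after [b], so its sign is [-1] and cancels the sign of the
   minor. *)
- rewrite mulr0 sub0r /side_sign ltnNge (ltnW (leq_ltn_trans (frame_bmin ab Yi) ij)) /=.
  rewrite mulrN1 mulNr opprK mulr_gt0//; split=> //.
  by rewrite depC (negbTE (blocks_far bl Tj Yj Yi)).
(* Otherwise [i] would be in the wrapped-around part of the class of [a], which [blocks_lt] puts
   after every transverse index. *)
- have ib : (i < b)%N.
    rewrite ltn_neqAle leqNgt; apply/andP; split.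
      by apply: contraNneq Yi => /val_inj ->; exact: frame_b ab.
    apply: contraTN ij => bi; rewrite -leqNgt; apply: ltnW.
    exact: (blocks_lt bl Ti Yi Yj bi).
  rewrite mulr0 subr0 /side_sign ib mulr1 mulr_gt0//; split=> //.
  by rewrite (negbTE (blocks_far bl Ti Yi Yj)).
- rewrite !mulr0 subrr; split=> //.
  by rewrite (blocks_near bl Yi Yj nij).
Qed.

(** * Recovering the parameters from a realizing matrix *)

Section Inverse.
Context (A : 'M[R]_(2, n)).
Hypothesis rA : realizes D A.

Local Notation x := (xcoord a b A).
Local Notation y := (ycoord a b A).
Local Notation s := (slope a b A).

(** By Cramer's rule, the coordinate matrix differs from [A] by a left factor only, so it represents
    the same plane. *)
Lemma frame_mulmx : A = colsub (tnth [tuple a; b]) A *m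
  \matrix_(r < 2, j < n) (if r == 0 then x j else y j).
Proof.
apply/matrixP => r j; rewrite !mxE !big_ord_recl big_ord0 !mxE /= !(tnth_nth a) /= addr0.
have := minor2_frame_neq0 ab rA; rewrite /xcoord /ycoord !minor2E => p0.
have [->|->] : r = 0 \/ r = 1.
  by case: r => [[|[|//]] p]; [left|right]; exact: val_inj.
all: by field.
Qed.

Lemma side_xcoord_gt0 j : j \notin T_set D -> ~~ transverse j -> 0 < side_sign j * x j.
Proof.
move=> Tj Yj; rewrite /side_sign; case: ltngtP => [jb|bj|/val_inj e].
- by rewrite mul1r (xcoord_gt0 ab rA).
- by rewrite mulN1r oppr_gt0 (xcoord_lt0 ab rA).
- by rewrite e (frame_b ab) in Yj.
Qed.

Lemma slope_leader k : k \in leaders -> 0 < s (prev_transverse k) - s k.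
Proof.
move=> /leadersP[Yk kb lk]; have [Yp pk _] := prev_transverseP Yk kb.
rewrite subr_gt0 lt_neqAle (slope_le ab rA Yp Yk (ltnW pk)) andbT.
by rewrite eq_sym (slope_eq ab rA)// ?lk// neq_ltn pk.
Qed.

(** Loop columns vanish on both sides; elsewhere [u] restores the scales and the telescoping of
    [step_slopeE] restores the slopes. *)
Lemma param_mx_coord u t :
  (forall j, j \notin T_set D ->
    expR (u j) = if transverse j then y j else side_sign j * x j) ->
  (forall k, k \in leaders -> expR (t k) = s (prev_transverse k) - s k) ->
  param_mx u t = \matrix_(r < 2, j < n) (if r == 0 then x j else y j).
Proof.
move=> uE tE; apply/matrixP => r j; rewrite !mxE.
have [Tj|Tj] := boolP (j \in T_set D).
  have [-> ->] := loop_coord0 ab rA Tj.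
  have /negbTE Yj : ~~ transverse j by apply: contraL Tj; exact: transverse_nloop.
  by rewrite /param_x /param_y Tj Yj.
rewrite /param_x /param_y (negbTE Tj) uE//.
have [Yj|Yj] := boolP (transverse j); last first.
  rewrite (ycoord_eq0 b rA Yj) mulrAC.
  by rewrite /side_sign; case: (j < b)%N; rewrite ?mulrNN !mul1r.
rewrite (step_slopeE (slope_b _ _ _) _ tE Yj).
  by rewrite /slope mulrC divfK// gt_eqF// (ycoord_gt0 ab rA).
move=> i i' Yi Yi' ii'; rewrite -(slope_eq ab rA)// ?neq_ltn ?ii'//.
by move/eqP.
Qed.

End Inverse.

End Parametrization.

(** * The homeomorphism *)

Section Spread.
Context (R : realType) (n : nat) (S : {set 'I_n}).
Implicit Types (v : 'rV[R]_#|S|) (h : 'I_n -> R).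

(* Extends by [0] outside [S] a vector indexed by an enumeration of [S]. *)
Definition spread v (j : 'I_n) : R := \sum_p (enum_val p == j)%:R * v 0 p.

Lemma spread_val v p : spread v (enum_val p) = v 0 p.
Proof.
rewrite /spread (bigD1 p)//= eqxx mul1r big1 ?addr0// => q qp.
by rewrite (inj_eq enum_val_inj) (negbTE qp) mul0r.
Qed.

Lemma spread_out v j : j \notin S -> spread v j = 0.
Proof.
move=> Sj; rewrite /spread big1// => p _; case: eqP => [pj|_]; last by rewrite mul0r.
by rewrite -pj enum_valP in Sj.
Qed.

Lemma spread_row h j : j \in S -> spread (\row_p h (enum_val p)) j = h j.
Proof. by move=> Sj; rewrite -(enum_rankK_in Sj Sj) spread_val mxE. Qed.

Lemma spread_continuous (X : topologicalType) (f : X -> 'rV[R]_#|S|) j (x : X) :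
  (forall p, {for x, continuous (fun y => f y 0 p)}) ->
  {for x, continuous (fun y => spread (f y) j)}.
Proof.
move=> fc; apply: continuous_sum => p _; apply: continuous_mulf; last exact: fc.
exact: cst_continuous.
Qed.

End Spread.

Section Cell.
Context (R : realType) (n : nat) (D : {set {set 'I_n}}) (a b : 'I_n).
Hypotheses (ab : frame D a b) (bl : blocks D a b).

Local Notation L := (leaders D a b).
Local Notation S := (S_plus R (pairs n :\: D)%SET).

Definition scaled : {set 'I_n} := (~: T_set D :\: [set a; b])%SET.

Local Notation V := ('rV[R]_(#|scaled| + #|L|)).

Definition ratio_slope j (W : Gr2 R n) : R :=
  plucker_ratio a b j b W / plucker_ratio a b a j W.

Definition log_scale j (W : Gr2 R n) : R :=
  ln (if transverse D a j then plucker_ratio a b a j W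
      else side_sign R b j * plucker_ratio a b j b W).

Definition log_step k (W : Gr2 R n) : R :=
  ln (ratio_slope (prev_transverse D a b k) W - ratio_slope k W).

Definition chart (W : S) : V :=
  row_mx (\row_p log_scale (enum_val p) (set_val W))
         (\row_p log_step (enum_val p) (set_val W)).

Definition chart_mx (w : V) : 'M[R]_(2, n) :=
  param_mx D a b (spread (lsubmx w)) (spread (rsubmx w)).

Lemma chart_mx_rank2 w : chart_mx w \in rank2 R n.
Proof.
rewrite inE; apply: (rank2_minor2 (i := a) (j := b)).
by apply: (minor2_frame_neq0 ab); exact: param_realizes.
Qed.

Definition chart_rank2 w : rank2 R n := SigSub (chart_mx_rank2 w).

Lemma Gr2_of_chart w : Gr2_of (chart_rank2 w) \in S.
Proof.
by rewrite inE; apply/S_plusP; exists (chart_rank2 w); split=> //; exact: param_realizes.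
Qed.

Definition chart_inv w : S := SigSub (Gr2_of_chart w).

Lemma S_realizer (W : S) : exists A : rank2 R n, Gr2_of A = set_val W /\ realizes D (set_val A).
Proof. by apply/S_plusP; exact: set_valP. Qed.

Lemma scaledP j : reflect [/\ j \notin T_set D, j != a & j != b] (j \in scaled).
Proof.
rewrite finset.in_setD finset.in_setC finset.in_set2 negb_or -andbA.
by apply: (iffP and3P) => -[? ? ?]; split.
Qed.

Lemma chartK : cancel chart chart_inv.
Proof.
move=> W; have [A [AW rA]] := S_realizer W.
apply: val_inj; rewrite /= -set_valE -AW.
apply/esym/(@Gr2_of_mulmx _ _ (colsub (tnth [tuple a; b]) (set_val A))).
rewrite {1}(frame_mulmx ab rA); congr (_ *m _); apply/esym.
rewrite set_valE /= /chart_mx /chart row_mxKl row_mxKr -AW.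
apply: (param_mx_coord ab bl rA) => [j Tj|k lk]; last first.
  rewrite (spread_row (log_step^~ (Gr2_of A)))// /log_step /ratio_slope !plucker_ratioE lnK//.
  by rewrite posrE; exact: (slope_leader ab rA).
(* At [a] and [b], both outside [scaled], [spread] is [0]; its exponential [1] is the normalized
   coordinate. *)
have [->|ja] := eqVneq j a.
  rewrite spread_out ?expR0 ?transverse_a; last by apply/negP => /scaledP[_]; rewrite eqxx.
  by rewrite /side_sign (frame_lt ab (frame_b ab)) mul1r /xcoord divff//
    (minor2_frame_neq0 ab rA).
have [->|jb] := eqVneq j b.
  rewrite spread_out ?expR0 ?(frame_b ab); last by apply/negP => /scaledP[_ _]; rewrite eqxx.
  by rewrite /ycoord divff// (minor2_frame_neq0 ab rA).
rewrite (spread_row (log_scale^~ (Gr2_of A))); last exact/scaledP.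
rewrite /log_scale !plucker_ratioE; have [Yj|Yj] := boolP (transverse D a j).
  by rewrite lnK// posrE; exact: (ycoord_gt0 ab rA).
by rewrite lnK// posrE; exact: (side_xcoord_gt0 ab rA).
Qed.

Lemma chart_invK : cancel chart_inv chart.
Proof.
move=> w; rewrite /chart /chart_inv /= set_valE /=.
set u := spread (lsubmx w); set t := spread (rsubmx w).
have ua : u a = 0 by apply: spread_out; apply/negP => /scaledP[_]; rewrite eqxx.
have ub : u b = 0 by apply: spread_out; apply/negP => /scaledP[_ _]; rewrite eqxx.
(* Columns [a] and [b] of [chart_mx w] form the identity, so the Plücker ratios below are simply its
   entries. *)
have mab : minor2 (chart_mx w) a b = 1.
  rewrite minor2_param -/u -/t (param_xa ab t ua) (param_yb ab ub) (param_ya D a u).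
  by rewrite mulr0 subr0 mulr1.
have xE j : plucker_ratio a b j b (Gr2_of (chart_rank2 w)) = param_x D a b u t j.
  rewrite plucker_ratioE set_valE /= mab divr1 minor2_param -/u -/t.
  by rewrite (param_yb ab ub) (param_xb ab u t) mul0r subr0 mulr1.
have yE j : plucker_ratio a b a j (Gr2_of (chart_rank2 w)) = param_y D a u j.
  rewrite plucker_ratioE set_valE /= mab divr1 minor2_param -/u -/t.
  by rewrite (param_xa ab t ua) (param_ya D a u) mulr0 subr0 mul1r.
have sE j : transverse D a j -> ratio_slope j (Gr2_of (chart_rank2 w)) = step_slope D a b t j.
  move=> Yj; rewrite /ratio_slope xE yE /param_x /param_y Yj.
  by rewrite (negbTE (transverse_nloop Yj)) mulrAC divff ?mul1r// gt_eqF// expR_gt0.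
rewrite -[RHS]hsubmxK; congr row_mx; apply/rowP => p; rewrite mxE.
- rewrite -[RHS](spread_val (lsubmx w)) -/u.
  have /scaledP[Tj ja jb] := enum_valP p.
  rewrite /log_scale xE yE /param_x /param_y (negbTE Tj).
  case: (transverse D a _); first by rewrite expRK.
  by rewrite mulrCA /side_sign; case: (_ < b)%N; rewrite ?mulrNN !mulr1 expRK.
- rewrite -[RHS](spread_val (rsubmx w)) -/t.
  have lk := enum_valP p; have /leadersP[Yk kb _] := lk.
  have [Yp _ _] := prev_transverseP ab Yk kb.
  by rewrite /log_step !sE// (step_slope_leader ab t lk) expRK.
Qed.

Lemma chart_inv_continuous : continuous chart_inv.
Proof.
have uc j : continuous (fun w : V => spread (lsubmx w) j).
  move=> w; apply: (@spread_continuous _ _ _ _ lsubmx) => p.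
  rewrite (_ : (fun y : V => _) = (fun y => y 0 (lshift _ p))); first exact: coord_continuous.
  by apply/funext => y; rewrite mxE.
have tc j : continuous (fun w : V => spread (rsubmx w) j).
  move=> w; apply: (@spread_continuous _ _ _ _ rsubmx) => p.
  rewrite (_ : (fun y : V => _) = (fun y => y 0 (rshift _ p))); first exact: coord_continuous.
  by apply/funext => y; rewrite mxE.
have ec (f : V -> R) : continuous f -> continuous (fun w => expR (f w)).
  by move=> fc w; apply: (@continuous_comp _ _ _ f expR); [exact: fc|exact: continuous_expR].
have cc (r : R) : continuous (fun _ : V => r) by exact: cst_continuous.
have sc j : continuous (fun w : V => step_slope D a b (spread (rsubmx w)) j).
  move=> w; rewrite /step_slope; apply: (@continuousN _ _ _ (fun w : V => \sum_(k in L | _) _)).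
  by apply: continuous_sum => k _; exact: ec.
apply: continuous_set_type => w.
apply: (@continuous_comp _ _ _ chart_rank2 (@Gr2_of R n)); last exact: Gr2_of_continuous.
apply: continuous_set_type => {}w; apply: continuous_mx => r j.
apply: (@eq_continuous_for _ _ (fun w : V => if r == 0
    then param_x D a b (spread (lsubmx w)) (spread (rsubmx w)) j
    else param_y D a (spread (lsubmx w)) j)).
  by move=> v; rewrite set_valE /= mxE.
case: (r == 0); rewrite /param_x /param_y.
  case: (j \in T_set D); first exact: cc.
  apply: continuous_mulf; first exact: ec.
  by case: (transverse D a j); [exact: sc|exact: cc].
by case: (transverse D a j); [exact: ec|exact: cc].
Qed.

(** A realizing matrix of [W] supplies what each operation needs at [W]: nonzero denominators and
    positive arguments of [ln]. *)
Lemma chart_continuous : continuous chart.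
Proof.
move=> W; have [A [AW rA]] := S_realizer W.
have qc i j : {for W, continuous (fun W : S => plucker_ratio a b i j (set_val W))}.
  apply: (@continuous_comp _ _ _ set_val (plucker_ratio a b i j)).
    exact: initial_continuous.
  by rewrite -AW; apply: plucker_ratio_continuous; exact: (minor2_frame_neq0 ab rA).
have lc (f : S -> R) : 0 < f W -> {for W, continuous f} ->
    {for W, continuous (fun W => ln (f W))}.
  move=> f0 fc; apply: (@continuous_comp _ _ _ f (@ln R)); first exact: fc.
  exact: continuous_ln.
have sc j : transverse D a j -> {for W, continuous (fun W : S => ratio_slope j (set_val W))}.
  move=> Yj; apply: continuous_mulf; first exact: qc.
  apply: continuous_invf; last exact: qc.
  by rewrite -AW plucker_ratioE gt_eqF// (ycoord_gt0 ab rA).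
apply: continuous_mx => i p; rewrite /chart.
case: (split_ordP p) => {}p ->.
- apply: (@eq_continuous_for _ _ (fun W : S => log_scale (enum_val p) (set_val W))).
    by move=> W'; rewrite row_mxEl mxE.
  have /scaledP[Tj ja jb] := enum_valP p.
  apply: lc.
    rewrite -AW !plucker_ratioE; case: ifPn => Yj; first exact: (ycoord_gt0 ab rA).
    exact: (side_xcoord_gt0 ab rA).
  case: (transverse D a _); first exact: qc.
  by apply: continuous_mulf; [exact: cst_continuous|exact: qc].
- apply: (@eq_continuous_for _ _ (fun W : S => log_step (enum_val p) (set_val W))).
    by move=> W'; rewrite row_mxEr mxE.
  have lk := enum_valP p; have /leadersP[Yk kb _] := lk.
  have [Yp _ _] := prev_transverseP ab Yk kb.
  apply: lc; last by apply: continuous_subf; exact: sc.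
  by rewrite -AW /ratio_slope !plucker_ratioE (slope_leader ab rA).
Qed.

Lemma S_plus_cell : is_cell_of_dim R S (#|scaled| + #|L|).
Proof.
apply: homeomorphic_trans (homeomorphic_ball _ _).
exists chart, chart_inv; split.
- exact: chart_continuous.
- exact: chart_inv_continuous.
- exact: chartK.
- exact: chart_invK.
Qed.

Lemma card_scaled : (#|scaled| + 2 + #|T_set D| = n)%N.
Proof.
have nab : a != b by rewrite neq_ltn (frame_lt ab (frame_b ab)).
have sub : [set a; b]%SET \subset (~: T_set D)%SET.
  apply/fintype.subsetP => i; rewrite finset.in_set2 finset.in_setC => /orP[]/eqP->.
    exact: frame_a ab.
  exact: transverse_nloop (frame_b ab).
have := cardsC (T_set D); have := cardsID [set a; b]%SET (~: T_set D)%SET.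
rewrite (finset.setIidPr sub) cards2 nab card_ord => e; apply: etrans.
by rewrite -e addnC [(_ + 2)%N]addnC.
Qed.

End Cell.

Theorem proposition4p1 (R : realType) (n : nat) (D : {set {set 'I_n}}) :
  (2 <= n)%N ->
  D \subset pairs n ->
  positroid R (pairs n :\: D)%SET ->
  exists d : nat,
    is_cell_of_dim R (S_plus R (pairs n :\: D)%SET) d /\
    d%:Z = n%:Z - #|T_set D|%:Z + (num_components D)%:Z - 4.
Proof.
move=> _ _ [_ D0 [W /S_plusP[A [_ rA]]]].
have [a [b ab]] := frame_exists D0.
exists (#|scaled D a b| + #|leaders D a b|)%N; split.
  exact/S_plus_cell/(realizes_blocks ab rA).
(* There are [n - |T| - 2] scales and [c - 2] slope drops, whence the constant 4. *)
rewrite (num_componentsE ab rA); have := card_scaled ab; lia.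
Qed.
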